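(* Let $P$ be the set of $(a,b,c)\in\mathbb{R}^3$ such that the signed measure $a\nu_0+b\nu_1+c\nu_2$ on $SG$ is a positive (i.e. nonnegative) measure. Then $P$ is the solid cone $$S=\{(a,b,c)\in\mathbb{R}^3:\ ab+bc+ca\ge 0,\ a+b+c\geq 0\},$$ and the boundary of $P$ is the set of $(a,b,c)$ such that $a\nu_0+b\nu_1+c\nu_2=\nu_h$ for some harmonic function $h$.
   Context: Let $q_0,q_1,q_2$ be the vertices of an equilateral triangle in $\mathbb{R}^2$, $F_i(x)=\frac12(x+q_i)$, and let $SG$ be the unique nonempty compact set with $SG=\bigcup_{i=0}^2F_i(SG)$. For a finite word $w=(w_1,\dots,w_m)$ in $\{0,1,2\}$ put $|w|=m$, $F_w=F_{w_1}\circ\cdots\circ F_{w_m}$. For continuous $u,v$ on $SG$ put $\mathcal{E}_m(u,v)=\left(\frac53\right)^m\sum_{|w|=m}\sum_{i<j}(u(F_wq_i)-u(F_wq_j))(v(F_wq_i)-v(F_wq_j))$, $\mathcal{E}(u,v)=\lim_m\mathcal{E}_m(u,v)$ (finite energy), $\mathcal{E}(u)=\mathcal{E}(u,u)$. A function $h$ is harmonic if $\mathcal{E}_m(h,h)$ is independent of $m$; harmonic functions (constants included) are uniquely determined by arbitrary values at $q_0,q_1,q_2$, and $h_i$ is the harmonic function with $h_i(q_j)=\delta_{ij}$. For $h$ harmonic, $\nu_h$ is the finite Borel measure on $SG$ with $\nu_h(F_wSG)=\left(\frac53\right)^{|w|}\mathcal{E}(h\circ F_w)$ for all $w$; $\nu_i=\nu_{h_i}$.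 *)

(* Defs.v *)
From HB Require Import structures.
From mathcomp Require Import all_boot all_order all_algebra.
From mathcomp Require Import all_classical all_reals all_analysis.

Set Implicit Arguments.
Unset Strict Implicit.
Unset Printing Implicit Defensive.

Import Order.TTheory GRing.Theory Num.Theory.
Import numFieldNormedType.Exports.

Local Open Scope classical_set_scope.
Local Open Scope ring_scope.

Section SierpinskiGasket.
Variable R : realType.

(* The library norm on ['rV[R]_2] is the sup norm; it gives the usual topology,
   but equilaterality needs the Euclidean distance. *)
Definition eucl_dist (x y : 'rV[R]_2) : R :=
  Num.sqrt (\sum_(k < 2) (x 0 k - y 0 k) ^+ 2).

Definition equilateral (q : 'I_3 -> 'rV[R]_2) : Prop :=
  exists2 s : R, 0 < s & forall i j, i != j -> eucl_dist (q i) (q j) = s.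

Variable q : 'I_3 -> 'rV[R]_2.

Definition Fmap (i : 'I_3) (x : 'rV[R]_2) : 'rV[R]_2 := 2^-1 *: (x + q i).

(* [Fword [:: w1; ...; wm] = Fmap w1 \o ... \o Fmap wm]. *)
Definition Fword (w : seq 'I_3) : 'rV[R]_2 -> 'rV[R]_2 :=
  foldr (fun i f => Fmap i \o f) id w.

Definition is_gasket (SG : set 'rV[R]_2) : Prop :=
  [/\ SG !=set0, compact SG & SG = \bigcup_(i in [set: 'I_3]) (Fmap i @` SG)].

(* Functions on SG are represented by functions on the plane, whose values
   outside SG are irrelevant: only points [Fword w (q i)] of SG occur below. *)
Definition energy_level (m : nat) (u v : 'rV[R]_2 -> R) : R :=
  (5 / 3) ^+ m * \sum_(w : m.-tuple 'I_3) \sum_(i < 3) \sum_(j < 3 | (i < j)%N)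
    (u (Fword w (q i)) - u (Fword w (q j))) *
    (v (Fword w (q i)) - v (Fword w (q j))).

(* Meaningful for [u], [v] of finite energy, that is when the limit exists. *)
Definition energy (u v : 'rV[R]_2 -> R) : R :=
  limn (fun m => energy_level m u v).

Definition sg_harmonic (SG : set 'rV[R]_2) (h : 'rV[R]_2 -> R) : Prop :=
  {within SG, continuous h} /\
  forall m n : nat, energy_level m h h = energy_level n h h.

End SierpinskiGasket.

(* The plane with its Borel sigma-algebra. *)
Definition borel_plane (R : realType) := g_sigma_algebraType (@open 'rV[R]_2).

(* A finite Borel measure on SG is represented by a finite Borel measure on the
   plane carried by SG. *)
Definition is_energy_measure (R : realType) (q : 'I_3 -> 'rV[R]_2)
    (SG : set 'rV[R]_2) (h : 'rV[R]_2 -> R)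
    (nu : {finite_measure set (borel_plane R) -> \bar R}) : Prop :=
  nu (~` SG) = 0%E /\
  forall w : seq 'I_3, nu (Fword q w @` SG) =
    ((5 / 3) ^+ size w * energy q (h \o Fword q w) (h \o Fword q w))%:E.

Definition comb_charge d (T : measurableType d) (R : realType)
    (nu : 'I_3 -> {finite_measure set T -> \bar R}) (a b c : R) :
    {charge set T -> \bar R} :=
  cadd (cadd (cscale a (charge_of_finite_measure (nu 0)))
             (cscale b (charge_of_finite_measure (nu 1))))
       (cscale c (charge_of_finite_measure (nu 2))).

Definition nonneg_charge d (T : measurableType d) (R : realType)
    (mu : {charge set T -> \bar R}) : Prop :=
  forall A, measurable A -> (0 <= mu A)%E.

Definition positive_set_of_coefs d (T : measurableType d) (R : realType)
    (nu : 'I_3 -> {finite_measure set T -> \bar R}) : set (R * R * R) :=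
  [set t | let: (a, b, c) := t in nonneg_charge (comb_charge nu a b c)].

Definition solid_cone (R : realType) : set (R * R * R) :=
  [set t | let: (a, b, c) := t in
    0 <= a * b + b * c + c * a /\ 0 <= a + b + c].
Arguments solid_cone : clear implicits.

Definition boundary (T : topologicalType) (A : set T) : set T :=
  closure A `\` interior A.

(* Equality of measures is tested on Borel sets only, since the values of
   library measures on non-measurable sets are unconstrained. *)
Definition energy_measure_coefs (R : realType) (q : 'I_3 -> 'rV[R]_2)
    (SG : set 'rV[R]_2)
    (nu : 'I_3 -> {finite_measure set (borel_plane R) -> \bar R}) :
    set (R * R * R) :=
  [set t | let: (a, b, c) := t in
    exists (h : 'rV[R]_2 -> R)
           (nuh : {finite_measure set (borel_plane R) -> \bar R}),
      [/\ sg_harmonic q SG h, is_energy_measure q SG h nuh &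
          forall A : set (borel_plane R),
            measurable A -> comb_charge nu a b c A = nuh A]].

(* Main.v *)
Require Import Defs.
From HB Require Import structures.
From mathcomp Require Import all_boot all_order all_algebra.
From mathcomp Require Import all_classical all_reals all_analysis.
From mathcomp Require Import ring lra.

Import Order.TTheory GRing.Theory Num.Theory.
Import numFieldNormedType.Exports.

(** Three facts carry the proof.

    Finite-dimensional reduction.  A harmonic function is determined on every
    cell by its values at the three corners, through the subdivision rule in
    which a new vertex receives 2/5, 2/5, 1/5 of the old corner values
    ([sg_harmonic_rule]).  The energy of [h] on the cell of a word [w] is thus a
    quadratic form in the three corner values of [h], invariant under adding
    constants; the forms of this kind in the values [x] make up a
    three-dimensional space and the measures [nu_i] span it, namely the energy
    measure of [h] is the combination of the [nu_i] with weights
    (x_i - x_j)(x_i - x_k) ([triangle_energy_harmonic_word]).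

    Dynamics of the weights.  Restricting a combination of the [nu_i] to the
    cell of [j] gives, after rescaling, another such combination.  On weights
    this is a linear map [weight_pull j] that preserves e2 = ab + bc + ca and
    replaces the sum s = a + b + c by s + 2 a_j; the mass of a cell is a
    positive multiple of the sum of the pulled back weights
    ([cell_energy_weight]).  The cone e2 >= 0, s >= 0 is stable under these
    maps, so its combinations are nonnegative on all cells.  If instead
    e2 = - D < 0 while s stays bounded, some weight is at most some fixed
    negative number, and always subdividing toward it decreases s by a fixed
    amount at each step, until a cell of negative mass is met
    ([neg_e2_neg_word]).

    From cells to Borel sets.  The masses of the cells of a given level add up
    to the total mass, which forces their overlaps to be null
    ([tight_measure_overlap]).
    Hence the sets that agree with a finite union of cells up to a null set form
    a ring, it generates the Borel sets because cells become small, and the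
    monotone class theorem extends nonnegativity from this ring
    ([nonneg_charge_setring]).

    The boundary of the cone is e2 = 0, s >= 0, which is also the range of the
    weights of harmonic functions ([measure_coef_cone],
    [measure_coef_exists]); weights are determined by the masses of the cells
    of level at most one ([cell_energy_weight_inj]). *)

Set Implicit Arguments.
Unset Strict Implicit.
Unset Printing Implicit Defensive.

Local Open Scope classical_set_scope.
Local Open Scope ring_scope.

(** * Harmonic subdivision of a triangle *)

Lemma ord3P (P : 'I_3 -> Prop) : P 0 -> P 1 -> P 2 -> forall i, P i.
Proof.
move=> P0 P1 P2 [[|[|[|//]]] lt_i].
- by have -> : Ordinal lt_i = 0 by apply/val_inj.
- by have -> : Ordinal lt_i = 1 by apply/val_inj.
- by have -> : Ordinal lt_i = 2 by apply/val_inj.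
Qed.

Lemma big_ord3 (V : nmodType) (F : 'I_3 -> V) :
  \sum_(i < 3) F i = F 0 + F 1 + F 2.
Proof.
rewrite !big_ord_recl big_ord0 addr0 addrA.
by congr (F _ + F _ + F _); apply/val_inj.
Qed.

Section HarmonicAlgebra.
Variable R : realFieldType.
Implicit Types (x y a : 'I_3 -> R) (w : seq 'I_3).

Definition triangle_energy x : R :=
  (x 0 - x 1) ^+ 2 + (x 0 - x 2) ^+ 2 + (x 1 - x 2) ^+ 2.

Lemma edge_sum_triangle_energy x :
  \sum_(i < 3) \sum_(j < 3 | (i < j)%N) (x i - x j) * (x i - x j)
  = triangle_energy x.
Proof.
under eq_bigr => i _ do rewrite big_mkcond big_ord3.
by rewrite big_ord3 /triangle_energy /=; ring.
Qed.

(** The sum form of the rule: the two ends [j] and [i] of an edge count twice,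
    the third corner once, over 5. *)
Definition harmonic_subdiv (j : 'I_3) x : 'I_3 -> R := fun i =>
  if i == j then x j else (x j + x i + (x 0 + x 1 + x 2)) / 5.

Definition harmonic_word x w : 'I_3 -> R :=
  foldl (fun y j => harmonic_subdiv j y) x w.

(** The weights of the energy measure of the harmonic function with corner
    values [x]: polarizing in the basis [unit_val], the mixed terms are
    eliminated because the three basis functions add up to a constant. *)
Definition measure_coef x : 'I_3 -> R :=
  fun i => \prod_(j < 3 | j != i) (x i - x j).

Lemma measure_coefE x : [/\ measure_coef x 0 = (x 0 - x 1) * (x 0 - x 2),
  measure_coef x 1 = (x 1 - x 0) * (x 1 - x 2) &
  measure_coef x 2 = (x 2 - x 0) * (x 2 - x 1)].
Proof.
rewrite /measure_coef; split; rewrite big_mkcond /= !big_ord_recl big_ord0 /=;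
  rewrite ?mul1r ?mulr1; congr ((_ - x _) * (_ - x _)); exact/val_inj.
Qed.

Definition unit_val (i : 'I_3) : 'I_3 -> R := fun j => (i == j)%:R.

(** Induction on the word: composing with one subdivision reduces the claim to a
    polynomial identity between the weights of [harmonic_subdiv j x] and those
    of its three basis components. *)
Lemma triangle_energy_harmonic_word w x :
  triangle_energy (harmonic_word x w) =
  \sum_(i < 3) measure_coef x i * triangle_energy (harmonic_word (unit_val i) w).
Proof.
elim: w x => [|j w IH] x /=.
  rewrite big_ord3; have [-> -> ->] := measure_coefE x.
  by rewrite /triangle_energy /unit_val /=; ring.
rewrite IH.
under [RHS]eq_bigr do rewrite IH.
rewrite !big_ord3.
have [-> -> ->] := measure_coefE x.
have [-> -> ->] := measure_coefE (harmonic_subdiv j x).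
have [-> -> ->] := measure_coefE (harmonic_subdiv j (unit_val 0)).
have [-> -> ->] := measure_coefE (harmonic_subdiv j (unit_val 1)).
have [-> -> ->] := measure_coefE (harmonic_subdiv j (unit_val 2)).
rewrite /harmonic_subdiv /unit_val.
by elim/ord3P: j => /=; field.
Qed.

Lemma triangle_energy_ge0 x : 0 <= triangle_energy x.
Proof. by rewrite /triangle_energy !addr_ge0 ?sqr_ge0. Qed.

Lemma triangle_energy_unit_val i : triangle_energy (unit_val i) = 2.
Proof. by elim/ord3P: i; rewrite /triangle_energy /unit_val /=; ring. Qed.

(** The energy of the deviation of [z] from the harmonic subdivision of [x],
    summed over the three subtriangles: an inner edge joins two new vertices,
    and every new vertex is joined to two old corners, where the deviation
    vanishes. *)
Definition subdiv_excess x (z : 'I_3 -> 'I_3 -> R) : R :=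
  triangle_energy (fun i => if i == 0 then z 0 1 - harmonic_subdiv 0 x 1
    else if i == 1 then z 0 2 - harmonic_subdiv 0 x 2
    else z 1 2 - harmonic_subdiv 1 x 2)
  + 2 * ((z 0 1 - harmonic_subdiv 0 x 1) ^+ 2 +
  (z 0 2 - harmonic_subdiv 0 x 2) ^+ 2 + (z 1 2 - harmonic_subdiv 1 x 2) ^+ 2).

(** Here [z j] lists the corner values of the [j]-th subtriangle.  The cross term
    between the harmonic subdivision and the deviation vanishes because each new
    vertex of the harmonic subdivision is the mean of its four neighbors. *)
Lemma sum_triangle_energy_subdiv x (z : 'I_3 -> 'I_3 -> R) :
  (forall j, z j j = x j) -> (forall i j, z i j = z j i) ->
  \sum_(j < 3) triangle_energy (z j) =
  3 / 5 * triangle_energy x + subdiv_excess x z.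
Proof.
move=> zx zC; rewrite big_ord3 /subdiv_excess /triangle_energy /harmonic_subdiv /=.
rewrite !zx (zC 1 0) (zC 2 0) (zC 2 1).
by field.
Qed.

Lemma subdiv_excess_ge0 x z : 0 <= subdiv_excess x z.
Proof.
by rewrite addr_ge0 ?triangle_energy_ge0// mulr_ge0// !addr_ge0 ?sqr_ge0.
Qed.

Lemma subdiv_excess_eq0 x (z : 'I_3 -> 'I_3 -> R) :
  (forall j, z j j = x j) -> (forall i j, z i j = z j i) ->
  subdiv_excess x z = 0 -> forall j, z j = harmonic_subdiv j x.
Proof.
move=> zx zC /eqP; rewrite paddr_eq0 ?triangle_energy_ge0//; last first.
  by rewrite mulr_ge0// !addr_ge0 ?sqr_ge0.
case/andP => _; rewrite mulf_eq0 pnatr_eq0 /= !paddr_eq0 ?addr_ge0 ?sqr_ge0//.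
rewrite !sqrf_eq0 !subr_eq0 => /andP[/andP[/eqP e01 /eqP e02] /eqP e12] j.
apply/funext => i.
elim/ord3P: j; elim/ord3P: i => //; rewrite ?zx // zC ?e01 ?e02 ?e12
  /harmonic_subdiv /=; ring.
Qed.

Lemma harmonic_subdivC x i j : harmonic_subdiv i x j = harmonic_subdiv j x i.
Proof.
by rewrite /harmonic_subdiv eq_sym; case: eqP => [->//|_]; rewrite [x i + _]addrC.
Qed.

Lemma sum_triangle_energy_harmonic x :
  \sum_(j < 3) triangle_energy (harmonic_subdiv j x) = 3 / 5 * triangle_energy x.
Proof.
rewrite (@sum_triangle_energy_subdiv x); first last.
- by move=> i j; rewrite harmonic_subdivC.
- by move=> j; rewrite /harmonic_subdiv eqxx.
by rewrite /subdiv_excess /triangle_energy !subrr /=; ring.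
Qed.

Lemma big_tuple_rcons (V : nmodType) n (F : seq 'I_3 -> V) :
  \sum_(w : n.+1.-tuple 'I_3) F w =
  \sum_(w : n.-tuple 'I_3) \sum_(j < 3) F (rcons w j).
Proof.
rewrite pair_big /= (reindex (fun p : n.-tuple 'I_3 * 'I_3 =>
  [tuple of rcons p.1 p.2])) //=.
apply/onW_bij/inj_card_bij; last by rewrite card_prod !card_tuple expnSr.
move=> [w i] [v j] /= /(congr1 val) /= /rcons_inj [wv ->].
by congr (_, _); apply/val_inj.
Qed.

Lemma harmonic_word_rcons x w j :
  harmonic_word x (rcons w j) = harmonic_subdiv j (harmonic_word x w).
Proof. by rewrite /harmonic_word -cats1 foldl_cat. Qed.

Lemma sum_triangle_energy_harmonic_word n x :
  (5 / 3) ^+ n * \sum_(w : n.-tuple 'I_3) triangle_energy (harmonic_word x w) =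
  triangle_energy x.
Proof.
elim: n => [|n IH].
  rewrite expr0 mul1r (big_pred1 [tuple]) // => w.
  by apply/esym/eqP; rewrite (tuple0 w).
rewrite (big_tuple_rcons n (fun w => triangle_energy (harmonic_word x w))).
rewrite -[RHS]IH exprSr -mulrA; congr (_ * _).
rewrite mulr_sumr; apply: eq_bigr => w _.
under eq_bigr do rewrite harmonic_word_rcons.
by rewrite sum_triangle_energy_harmonic; field.
Qed.

Lemma harmonic_word_sum (c : 'I_3 -> R) (y : 'I_3 -> 'I_3 -> R) w :
  harmonic_word (fun i => \sum_k c k * y k i) w =
  fun i => \sum_k c k * harmonic_word (y k) w i.
Proof.
elim: w y => [//|j w IH] y /=; rewrite -IH; congr harmonic_word.
apply/funext => i; rewrite /harmonic_subdiv; case: ifP => // _.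
by rewrite !big_ord3; field.
Qed.

End HarmonicAlgebra.

(** * Weights of combinations of energy measures *)

Section Weights.
Variable R : realFieldType.
Implicit Types (x y a : 'I_3 -> R) (w : seq 'I_3).

Definition weight_sum a : R := a 0 + a 1 + a 2.
Definition weight_e2 a : R := a 0 * a 1 + a 1 * a 2 + a 2 * a 0.

(** The weights of a combination seen from the subcell [j], up to the positive
    factor 3/25.  This normalization makes [weight_e2] exactly invariant. *)
Definition weight_pull (j : 'I_3) a : 'I_3 -> R := fun i =>
  if i == j then (7 * a j + 2 * weight_sum a) / 3
  else (3 * a i + a j - weight_sum a) / 3.

(** [weight_pull j] is, up to a positive factor, the transpose of the effect of
    [harmonic_subdiv j] on [measure_coef]. *)
Lemma weight_pull_energy j a w :
  \sum_(i < 3) a i * triangle_energy (harmonic_word (unit_val R i) (j :: w)) =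
  3 / 25 * \sum_(i < 3) weight_pull j a i *
     triangle_energy (harmonic_word (unit_val R i) w).
Proof.
under eq_bigr do rewrite /= triangle_energy_harmonic_word.
rewrite !big_ord3.
have [-> -> ->] := measure_coefE (harmonic_subdiv j (unit_val R 0)).
have [-> -> ->] := measure_coefE (harmonic_subdiv j (unit_val R 1)).
have [-> -> ->] := measure_coefE (harmonic_subdiv j (unit_val R 2)).
rewrite /harmonic_subdiv /weight_pull /weight_sum /unit_val.
by elim/ord3P: j => /=; field.
Qed.

Definition weight_pull_word a w : 'I_3 -> R :=
  foldl (fun b j => weight_pull j b) a w.

Lemma cell_energy_weight a w :
  \sum_(i < 3) a i * triangle_energy (harmonic_word (unit_val R i) w) =
  2 * (3 / 25) ^+ size w * weight_sum (weight_pull_word a w).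
Proof.
elim: w a => [|j w IH] a.
  by rewrite !big_ord3 !triangle_energy_unit_val /weight_sum /= expr0; ring.
by rewrite weight_pull_energy IH /= exprS; ring.
Qed.

Lemma weight_sum_pull j a : weight_sum (weight_pull j a) = weight_sum a + 2 * a j.
Proof. by rewrite /weight_pull /weight_sum; elim/ord3P: j => /=; field. Qed.

Lemma weight_e2_pull j a : weight_e2 (weight_pull j a) = weight_e2 a.
Proof. by rewrite /weight_pull /weight_e2 /weight_sum; elim/ord3P: j => /=; field. Qed.

Definition weight_cone a : Prop := 0 <= weight_e2 a /\ 0 <= weight_sum a.

(** With [t = a j], bounding the product of the two other weights by
    [(s - t)^2 / 4] gives [e2 <= (s - t) (s + 3 t) / 4].  If [t < 0 <= s] this
    forces [s + 3 t >= 0], and the new sum [s + 2 t] is larger. *)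
Lemma weight_cone_pull j a : weight_cone a -> weight_cone (weight_pull j a).
Proof.
move=> [e2a sa]; split; first by rewrite weight_e2_pull.
rewrite weight_sum_pull; move: e2a sa; rewrite /weight_e2 /weight_sum => e2a sa.
have key (s t : R) : 0 <= s -> 0 <= t * (s - t) + (s - t) ^+ 2 / 4 -> 0 <= s + 2 * t.
  by move=> s0 st; rewrite leNgt; apply/negP => lt0; nra.
apply: key => //.
by elim/ord3P: j; [have := sqr_ge0 (a 1 - a 2)|have := sqr_ge0 (a 0 - a 2)|
  have := sqr_ge0 (a 0 - a 1)]; nra.
Qed.

Lemma weight_cone_sum_pull_word a w :
  weight_cone a -> 0 <= weight_sum (weight_pull_word a w).
Proof. by elim: w a => [a []//|j w IH a /(weight_cone_pull j) /IH]. Qed.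

(** If all weights are greater than [- e], expanding the products of the
    positive numbers [a_i + e] bounds [e2] below by [- 2 e S - 3 e ^ 2], which
    exceeds [- D] for small [e]. *)
Lemma neg_e2_neg_weight (D S : R) : 0 < D -> 0 <= S ->
  exists2 e : R, 0 < e & forall a, weight_e2 a = - D -> 0 <= weight_sum a <= S ->
    exists j, a j <= - e.
Proof.
move=> D0 S0; have dD : 0 < 2 * S + 3 + D by lra.
(* This [e] is less than 1 and satisfies e (2 S + 3) < D. *)
exists (D / (2 * S + 3 + D)); first by rewrite divr_gt0.
set e := D / _; have e0 : 0 < e by rewrite divr_gt0.
have eD : e * (2 * S + 3 + D) = D by rewrite /e divfK// gt_eqF.
have e1 : e <= 1 by nra.
move=> a aD /andP[s0 sS].
have [?|a0] := leP (a 0) (- e); first by exists 0.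
have [?|a1] := leP (a 1) (- e); first by exists 1.
have [?|a2] := leP (a 2) (- e); first by exists 2.
move: aD s0 sS; rewrite /weight_e2 /weight_sum => aD s0 sS.
have p01 : 0 < (a 0 + e) * (a 1 + e) by apply: mulr_gt0; lra.
have p12 : 0 < (a 1 + e) * (a 2 + e) by apply: mulr_gt0; lra.
have p20 : 0 < (a 2 + e) * (a 0 + e) by apply: mulr_gt0; lra.
have pS : 0 <= e * (S - (a 0 + a 1 + a 2)) by apply: mulr_ge0; lra.
have pe : 0 <= e * (1 - e) by apply: mulr_ge0; lra.
have pD : 0 < e * D by apply: mulr_gt0.
by exfalso; nra.
Qed.

Lemma measure_coef_cone x :
  weight_e2 (measure_coef x) = 0 /\ 0 <= weight_sum (measure_coef x).
Proof.
rewrite /weight_e2 /weight_sum; have [-> -> ->] := measure_coefE x; split; first ring.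
have := sqr_ge0 (x 0 - x 1); have := sqr_ge0 (x 0 - x 2).
have := sqr_ge0 (x 1 - x 2); nra.
Qed.

(** The whole gasket determines the sum of the weights, and then the cell of
    [j] determines the weight [a j], because [weight_pull j] adds [2 a_j] to the
    sum. *)
Lemma cell_energy_weight_inj a b :
  (forall w, \sum_(i < 3) a i * triangle_energy (harmonic_word (unit_val R i) w) =
   \sum_(i < 3) b i * triangle_energy (harmonic_word (unit_val R i) w)) -> a = b.
Proof.
move=> ab; have := ab [::]; rewrite !cell_energy_weight /= expr0 => sab.
apply/funext => j; have := ab [:: j]; rewrite !cell_energy_weight /=.
by rewrite !weight_sum_pull expr1; lra.
Qed.

End Weights.

(** Put the value 0 at the first corner.  The weights of [(0, -p, -u)] are
    [p u], [p (p - u)], [u (u - p)], so that [p ^ 2 = a 0 + a 1],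
    [u ^ 2 = a 0 + a 2], and for [p >= 0] the sign of [u] is that of [a 0]. *)
Lemma measure_coef_exists (R : rcfType) (a : 'I_3 -> R) :
  weight_e2 a = 0 -> 0 <= weight_sum a -> exists x, measure_coef x = a.
Proof.
rewrite /weight_e2 /weight_sum => e2a sa.
have P01 : (a 0 + a 1) * (a 0 + a 2) = a 0 ^+ 2 by rewrite -[RHS]addr0 -e2a; ring.
have P12 : (a 0 + a 1) * (a 1 + a 2) = a 1 ^+ 2 by rewrite -[RHS]addr0 -e2a; ring.
have P20 : (a 0 + a 2) * (a 1 + a 2) = a 2 ^+ 2 by rewrite -[RHS]addr0 -e2a; ring.
have := sqr_ge0 (a 0); have := sqr_ge0 (a 1); have := sqr_ge0 (a 2).
rewrite -P01 -P12 -P20 => h2 h1 h0.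
have p0 : 0 <= a 0 + a 1 by rewrite leNgt; apply/negP => lt0; nra.
have u0 : 0 <= a 0 + a 2 by rewrite leNgt; apply/negP => lt0; nra.
pose p := Num.sqrt (a 0 + a 1).
pose u := if 0 <= a 0 then Num.sqrt (a 0 + a 2) else - Num.sqrt (a 0 + a 2).
have pp : p * p = a 0 + a 1 by rewrite -expr2 sqr_sqrtr.
have uu : u * u = a 0 + a 2.
  by rewrite /u; case: ifP => _; rewrite ?mulrNN -expr2 sqr_sqrtr.
have pu : p * u = a 0.
  rewrite /u; case: ifP => a0; rewrite ?mulrN -sqrtrM// P01 sqrtr_sqr.
    by rewrite ger0_norm.
  by rewrite ltr0_norm ?opprK// ltNge a0.
exists (fun i => if i == 0 then 0 else if i == 1 then - p else - u).
apply/funext; have [e0 e1 e2] := measure_coefE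
  (fun i : 'I_3 => if i == 0 then 0 else if i == 1 then - p else - u).
by elim/ord3P; rewrite ?e0 ?e1 ?e2 /=; nra.
Qed.

(** Greedy descent: subdividing toward a sufficiently negative weight lowers the
    sum by at least [2 e], where [e] depends only on the invariant [weight_e2]
    and on the initial bound for the sum, which persists. *)
Lemma neg_e2_neg_word (R : archiRealFieldType) (a : 'I_3 -> R) : weight_e2 a < 0 ->
  exists w, weight_sum (weight_pull_word a w) < 0.
Proof.
move=> a0; have [?|s0] := ltP (weight_sum a) 0; first by exists [::].
have [||e e0 eP] := @neg_e2_neg_weight R (- weight_e2 a) (weight_sum a).
- by rewrite oppr_gt0.
- by [].
have [n nP] : exists n : nat, weight_sum a < 2 * e * n%:R.
  exists (Num.bound (weight_sum a / (2 * e))).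
  by rewrite mulrC -ltr_pdivrMr ?mulr_gt0// archi_boundP// divr_ge0// mulr_ge0// ltW.
move: eP; rewrite opprK; set E := weight_e2 a; set S := weight_sum a => eP.
have : weight_sum a <= S by []. have : weight_e2 a = E by [].
rewrite -/S in nP; have : weight_sum a < 2 * e * n%:R by [].
clearbody E S; elim: n a {a0 nP s0} => [|n IH] b bn bE bS.
  by exists [::]; rewrite mulr0 in bn.
have [?|s0] := ltP (weight_sum b) 0; first by exists [::].
have [|j jP] := eP b bE; first by rewrite s0.
have [||| w wP] := IH (weight_pull j b).
- by rewrite weight_sum_pull; move: bn; rewrite -natr1; lra.
- by rewrite weight_e2_pull.
- by rewrite weight_sum_pull; lra.
by exists (j :: w).
Qed.

(** * Energy of harmonic functions on cells *)

Section CellEnergy.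
Variables (R : realType) (q : 'I_3 -> 'rV[R]_2).
Implicit Types (h : 'rV[R]_2 -> R) (w v : seq 'I_3).

Lemma Fword_cat w v x : Fword q (w ++ v) x = Fword q w (Fword q v x).
Proof. by elim: w => //= i w ->. Qed.

Lemma Fword_rcons w j x : Fword q (rcons w j) x = Fword q w (Fmap q j x).
Proof. by rewrite -cats1 Fword_cat. Qed.

Definition vertex_val h w : 'I_3 -> R := fun i => h (Fword q w (q i)).

Definition harmonic_rule h :=
  forall w j, vertex_val h (rcons w j) = harmonic_subdiv j (vertex_val h w).

Lemma energy_levelE h n : energy_level q n h h =
  (5 / 3) ^+ n * \sum_(w : n.-tuple 'I_3) triangle_energy (vertex_val h w).
Proof.
congr (_ * _); apply: eq_bigr => w _.
by rewrite -edge_sum_triangle_energy.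
Qed.

Lemma Fmap_fix j : Fmap q j (q j) = q j.
Proof.
rewrite /Fmap -mulr2n -[q j *+ 2]scaler_nat scalerA.
by rewrite mulVf ?scale1r// pnatr_eq0.
Qed.

Lemma FmapC i j : Fmap q i (q j) = Fmap q j (q i).
Proof. by rewrite /Fmap addrC. Qed.

(** From one level to the next the energy changes by a sum of nonnegative
    excesses, one for each cell, so constancy of the energy forces each of them
    to vanish. *)
Lemma sg_harmonic_rule SG h : sg_harmonic q SG h -> harmonic_rule h.
Proof.
move=> [_ hE] w j.
have zx v i : vertex_val h (rcons v i) i = vertex_val h v i.
  by rewrite /vertex_val Fword_rcons Fmap_fix.
have zC v i k : vertex_val h (rcons v i) k = vertex_val h (rcons v k) i.
  by rewrite /vertex_val !Fword_rcons FmapC.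
pose exc v := subdiv_excess (vertex_val h v) (fun i => vertex_val h (rcons v i)).
have /eqP : \sum_(v : (size w).-tuple 'I_3) exc v = 0.
  have := hE (size w).+1 (size w).
  rewrite !energy_levelE exprSr -mulrA => /mulfI.
  rewrite expf_neq0 ?mulf_neq0 ?invr_neq0 ?pnatr_eq0// => /(_ isT).
  rewrite (big_tuple_rcons _ (fun v => triangle_energy (vertex_val h v))) mulr_sumr.
  under eq_bigr => v _.
    rewrite (sum_triangle_energy_subdiv (zx v) (zC v)) mulrDr mulrA.
    have -> : (5 / 3 * (3 / 5) : R) = 1 by field.
    rewrite mul1r -/(exc v).
    over.
  by rewrite big_split /= -mulr_sumr => excE; lra.
rewrite psumr_eq0 => [|v _]; last exact: subdiv_excess_ge0.
move=> /allP /(_ (in_tuple w)); rewrite mem_index_enum => /(_ isT) /eqP.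
by move=> /(subdiv_excess_eq0 (zx w) (zC w)) /(_ j).
Qed.

Lemma harmonic_rule_vertex_val h w : harmonic_rule h ->
  vertex_val h w = harmonic_word (vertex_val h [::]) w.
Proof.
move=> hh; elim/last_ind: w => [//|w j IH].
by rewrite hh IH harmonic_word_rcons.
Qed.

Lemma harmonic_rule_energy_level h w n : harmonic_rule h ->
  energy_level q n (h \o Fword q w) (h \o Fword q w) =
  triangle_energy (harmonic_word (vertex_val h [::]) w).
Proof.
move=> hh; rewrite energy_levelE -[RHS](sum_triangle_energy_harmonic_word n).
congr (_ * _); apply: eq_bigr => v _; congr triangle_energy.
transitivity (vertex_val h (w ++ v)).
  by apply/funext => i; rewrite /vertex_val /= Fword_cat.
by rewrite harmonic_rule_vertex_val// /harmonic_word foldl_cat.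
Qed.

Lemma harmonic_rule_energy h w : harmonic_rule h ->
  energy q (h \o Fword q w) (h \o Fword q w) =
  triangle_energy (harmonic_word (vertex_val h [::]) w).
Proof.
move=> hh; rewrite /energy; under eq_fun do rewrite harmonic_rule_energy_level//.
exact: lim_cst.
Qed.

End CellEnergy.

(** * From cells to a sigma-algebra *)

Lemma le_measure_monotone d (T : measurableType d) (R : realType)
    (m1 m2 : {finite_measure set T -> \bar R}) :
  monotone [set A : set T | measurable A /\ (m1 A <= m2 A)%E].
Proof.
split=> F mono FP; have mF n : measurable (F n) by have [] := FP n.
- have mU : measurable (\bigcup_n F n) by exact: bigcupT_measurable.
  split=> //; apply: (@lee_cvg_to _ (\oo) _ _ (m1 \o F) (m2 \o F)).
  + exact: nondecreasing_cvg_mu.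
  + exact: nondecreasing_cvg_mu.
  + by apply: nearW => n /=; have [] := FP n.
- have mI : measurable (\bigcap_n F n) by exact: bigcapT_measurable.
  split=> //; apply: (@lee_cvg_to _ (\oo) _ _ (m1 \o F) (m2 \o F)).
  + by apply: nonincreasing_cvg_mu => //; rewrite -ge0_fin_numE// fin_num_measure.
  + by apply: nonincreasing_cvg_mu => //; rewrite -ge0_fin_numE// fin_num_measure.
  + by apply: nearW => n /=; have [] := FP n.
Qed.

(** With the Jordan decomposition, [0 <= mu A] compares two finite measures, a
    condition that passes to monotone limits; the monotone class theorem
    applies. *)
Lemma nonneg_charge_setring d (T : measurableType d) (R : realType)
    (mu : {charge set T -> \bar R}) (G : set (set T)) :
  setring G -> G `<=` measurable -> (forall A, G A -> (0 <= mu A)%E) ->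
  forall A, <<sr G>> A -> (0 <= mu A)%E.
Proof.
move=> ringG mG posG A srA.
have [P [N PN]] := Hahn_decomposition mu.
pose p : {finite_measure set T -> \bar R} := jordan_pos PN.
pose n : {finite_measure set T -> \bar R} := jordan_neg PN.
have muE B : measurable B -> mu B = (p B - n B)%E.
  by move=> mB; rewrite (jordan_decomp PN mB) /cadd /= cscaleN1.
have muP B : measurable B -> (0 <= mu B)%E = (n B <= p B)%E.
  by move=> mB; rewrite muE// sube_ge0// fin_num_measure.
have := monotone_setring_sub_g_sigma_ring (le_measure_monotone n p) ringG.
move=> /(_ _ A srA) []; last by move=> mA; rewrite muP.
by move=> B GB; split; [exact: mG | rewrite -muP; [exact: posG|exact: mG]].
Qed.

(** The values of a charge at non-measurable sets are arbitrary, so the charge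
    itself need not be a measure; its positive part is one and agrees with it on
    measurable sets. *)
Lemma nonneg_charge_finite_measure d (T : measurableType d) (R : realType)
    (mu : {charge set T -> \bar R}) : nonneg_charge mu ->
  exists m : {finite_measure set T -> \bar R},
    forall A, measurable A -> m A = mu A.
Proof.
move=> pos; have [P [N PN]] := Hahn_decomposition mu.
have [[mP _] [mN negN] PNT PN0] := PN.
exists (jordan_pos PN) => A mA.
have muN : mu (A `&` N) = 0%E.
  apply/eqP; rewrite eq_le negN//= ?pos//; exact: measurableI.
rewrite (charge_partition mu mA mP mN PNT PN0) muN adde0.
by rewrite /= jordan_posE cjordan_posE /crestr0 mem_set.
Qed.

(** A finite family is tight when the measure of its union is the sum of the
    measures, that is, when the union bound is an equality.  The union bound
    for a subfamily and that for its complement add up to the one for the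
    family, so tightness passes to subfamilies; for a pair it says that the
    overlap is null. *)
Section TightFamily.
Context d (T : measurableType d) (R : realType).
Variables (nu : {finite_measure set T -> \bar R}) (I : finType) (F : I -> set T).
Hypothesis mF : forall i, measurable (F i).

Let union (P : pred I) : set T := \bigcup_(i in [set i | P i]) F i.

Lemma measurable_finite_union (P : pred I) : measurable (union P).
Proof. by apply: fin_bigcup_measurable => //; exact: finite_finset. Qed.

Lemma finite_unionE (P : pred I) : union P = \big[setU/set0]_(i | P i) F i.
Proof.
rewrite -bigcup_seq_cond; congr (bigcup _ _).
by apply/seteqP; split => i /=; rewrite mem_index_enum.
Qed.

Lemma le_measure_finite_union (P : pred I) :
  (nu (union P) <= \sum_(i | P i) nu (F i))%E.
Proof.
rewrite finite_unionE.
suff [] : measurable (\big[setU/set0]_(i | P i) F i) /\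
  (nu (\big[setU/set0]_(i | P i) F i) <= \sum_(i | P i) nu (F i))%E by [].
apply: (big_ind2 (fun A r => measurable A /\ (nu A <= r)%E)).
- by rewrite measure0.
- move=> A r B s [mA Ar] [mB Bs]; split; first exact: measurableU.
  by rewrite (le_trans (measureU2 _ mA mB))// leeD.
- by [].
Qed.

Hypothesis tight : nu (\bigcup_i F i) = (\sum_i nu (F i))%E.

Lemma tight_measure_finite_union (P : pred I) :
  nu (union P) = (\sum_(i | P i) nu (F i))%E.
Proof.
apply/eqP; rewrite eq_le le_measure_finite_union /= leNgt; apply/negP => ltP.
have := tight; rewrite (bigID P) /=; apply/eqP; rewrite lt_eqF//.
have mP := measurable_finite_union.
have -> : \bigcup_i F i = union P `|` union (predC P).
  apply/seteqP; split=> [x [i _ Fi]|x [] [i _ Fi]]; [|by exists i..].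
  by have [Pi|Pi] := boolP (P i); [left|right]; exists i.
apply: (le_lt_trans (measureU2 _ (mP P) (mP (predC P)))).
apply: lte_leD => //; last exact: le_measure_finite_union.
by rewrite fin_num_measure.
Qed.

Lemma tight_measure_overlap i j : i != j -> nu (F i `&` F j) = 0%E.
Proof.
move=> ij; have := tight_measure_finite_union (pred2 i j).
have -> : union (pred2 i j) = F i `|` F j.
  apply/seteqP; split=> [x [k /= /orP[] /eqP -> Fk]|x [Fx|Fx]].
  - by left.
  - by right.
  - by exists i; rewrite //= eqxx.
  - by exists j; rewrite //= eqxx orbT.
rewrite (bigD1 i) /= ?eqxx// (big_pred1 j); last first.
  move=> k /=; have [->|] := eqVneq k i; last by rewrite andbT.
  by rewrite (negbTE ij).
have fin A : measurable A -> nu A = (fine (nu A))%:E.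
  by move=> mA; rewrite fineK// fin_num_measure.
have mI : measurable (F i `&` F j) by exact: measurableI.
have finj : (nu (F j) < +oo)%E by rewrite (fin _ (mF j)) ltry.
have -> : nu (F i `|` F j) = (nu (F i) + nu (F j) - nu (F i `&` F j))%E.
  exact: measureUfinr.
rewrite (fin _ mI) (fin _ (mF i)) (fin _ (mF j)) -!EFinD => -[e].
by congr (_%:E); lra.
Qed.

End TightFamily.

(** Abstract cell structures: every cell is the union of its children, indexed
    by the letters of a finite alphabet; children may overlap.  Each measure of
    the family [nu] gives the root cell the sum of the masses of the cells of
    any given level. *)
Section CellRing.
Context d (T : measurableType d) (R : realType).
Variables (I : finType) (cell : seq I -> set T).
Hypothesis mcell : forall w, measurable (cell w).
Hypothesis cell_rcons : forall w, cell w = \bigcup_j cell (rcons w j).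

Definition cell_union n (W : pred (seq I)) : set T :=
  \bigcup_(w in [set w : n.-tuple I | W w]) cell w.

Lemma cell_unionP n W x :
  cell_union n W x <-> exists w, [/\ size w = n, W w & cell w x].
Proof.
split=> [[w Ww wx]|[w [wn Ww wx]]]; first by exists w; rewrite size_tuple.
by move/eqP: wn => wn; exists (Tuple wn).
Qed.

Lemma measurable_cell_union n W : measurable (cell_union n W).
Proof. exact: (@measurable_finite_union _ _ _ (fun w : n.-tuple I => cell w)). Qed.

Lemma sub_cell_cat w v : cell (w ++ v) `<=` cell w.
Proof.
elim/last_ind: v => [|v j IH]; first by rewrite cats0.
by apply: subset_trans IH; rewrite -rcons_cat (cell_rcons (w ++ v)); exact: bigcup_sup.
Qed.

Lemma cell_subcell m w x : cell w x -> exists2 v, size v = m & cell (w ++ v) x.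
Proof.
move=> wx; elim: m => [|m [v <- vx]]; first by exists [::]; rewrite ?cats0.
move: vx; rewrite cell_rcons => -[j _ jx].
by exists (rcons v j); rewrite ?size_rcons// -rcons_cat.
Qed.

Lemma cell_union_refine n m W :
  cell_union n W = cell_union (n + m)%N (fun v => W (take n v)).
Proof.
apply/seteqP; split=> x /cell_unionP [w [wn Ww wx]]; apply/cell_unionP.
- have [v vm vx] := cell_subcell m wx.
  by exists (w ++ v); rewrite size_cat wn vm -wn take_size_cat.
- exists (take n w); split=> //; first by rewrite size_takel// wn leq_addr.
  by apply: (@sub_cell_cat _ (drop n w)); rewrite cat_take_drop.
Qed.

Lemma cell_union_all n : cell_union n xpredT = cell [::].
Proof.
rewrite -[n]add0n -(cell_union_refine 0 n xpredT).
apply/seteqP; split=> x; first by move/cell_unionP => [w [/size0nil ->]].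
by move=> x0; apply/cell_unionP; exists [::].
Qed.

Variables (K : Type) (nu : K -> {finite_measure set T -> \bar R}).
Hypothesis nu_carried : forall k, nu k (~` cell [::]) = 0%E.
Hypothesis nu_tight : forall k n,
  nu k (cell [::]) = (\sum_(w : n.-tuple I) nu k (cell w))%E.

Let nu_tight' k n :
  nu k (\bigcup_(w : n.-tuple I) cell w) = (\sum_(w : n.-tuple I) nu k (cell w))%E.
Proof.
rewrite -nu_tight -(cell_union_all n); congr (nu k _).
by apply/seteqP; split=> x [w _ wx]; exists w.
Qed.

Lemma measure_cell_union k n W :
  nu k (cell_union n W) = (\sum_(w : n.-tuple I | W w) nu k (cell w))%E.
Proof.
exact: (@tight_measure_finite_union _ _ _ (nu k) _
  (fun w : n.-tuple I => cell w) (fun w => mcell w) (nu_tight' k n) (fun w => W w)).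
Qed.

Definition null_set (A : set T) := measurable A /\ forall k, nu k A = 0%E.

Lemma null_set_sub A B : measurable A -> A `<=` B -> null_set B -> null_set A.
Proof.
by move=> mA AB [mB B0]; split=> // k; exact: (subset_measure0 mA mB AB (B0 k)).
Qed.

Lemma null_setU A B : null_set A -> null_set B -> null_set (A `|` B).
Proof.
move=> [mA A0] [mB B0]; split=> [|k]; first exact: measurableU.
exact: (null_set_setU mA mB (A0 k) (B0 k)).
Qed.

Lemma null_cell_union_overlap n (W V : pred (seq I)) : (forall w, W w -> ~~ V w) ->
  null_set (cell_union n W `&` cell_union n V).
Proof.
move=> WV; split=> [|k]; first by apply: measurableI; exact: measurable_cell_union.
pose F (p : n.-tuple I * n.-tuple I) := cell p.1 `&` cell p.2.
have mF p : measurable (F p) by exact: measurableI.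
pose P (p : n.-tuple I * n.-tuple I) := W p.1 && V p.2.
have mU : measurable (\bigcup_(p in [set p | P p]) F p).
  exact: measurable_finite_union.
apply: (@subset_measure0 _ _ _ _ _ (\bigcup_(p in [set p | P p]) F p)) => //.
- by apply: measurableI; exact: measurable_cell_union.
- move=> x [[w Ww wx] [v Vv vx]]; exists (w, v); last by split.
  by rewrite /= /P /=; apply/andP.
apply/eqP; rewrite -measure_le0.
apply: (le_trans (le_measure_finite_union _ mF _)).
rewrite big1// => -[w v] /andP [/= Ww Vv].
apply: (tight_measure_overlap _ (nu_tight' k n)) => //.
by apply/eqP => /= wv; have := WV _ Ww; rewrite wv Vv.
Qed.

Definition cell_ring : set (set T) := [set A | measurable A /\
  exists n W, null_set (A `+` cell_union n W)].

Lemma cell_ring_cell_union n W : cell_ring (cell_union n W).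
Proof.
split; first exact: measurable_cell_union.
by exists n, W; rewrite setYK; split.
Qed.

Lemma cell_ring_null A : null_set A -> cell_ring A.
Proof.
move=> A0; split; first by case: A0.
exists 0, xpred0; rewrite (_ : cell_union _ _ = set0) ?setY0//.
by apply/seteqP; split=> x // /cell_unionP [w []].
Qed.

(** Two members can be compared at a common level.  Differences are where null
    overlaps matter: removing the cells of [V] as sets also removes the points
    that they share with other cells of [W]. *)
Lemma setring_cell_ring : setring cell_ring.
Proof.
have join A B : cell_ring A -> cell_ring B -> exists n W V,
    null_set (A `+` cell_union n W) /\ null_set (B `+` cell_union n V).
  move=> [_ [n [W AW]]] [_ [m [V BV]]].
  exists (n + m)%N, (fun v => W (take n v)), (fun v => V (take m v)).
  by split; [rewrite -cell_union_refine|rewrite addnC -cell_union_refine].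
have mY (A B : set T) : measurable A -> measurable B -> measurable (A `+` B).
  by move=> mA mB; apply: measurableU; exact: measurableD.
have mC := measurable_cell_union.
split.
- by apply: cell_ring_null; split.
- move=> A B rA rB; have [n [W [V [AW BV]]]] := join _ _ rA rB.
  have [mA mB] : measurable A /\ measurable B by case: rA; case: rB.
  split; first exact: measurableU.
  exists n, (predU W V); apply: null_set_sub (null_setU AW BV).
    by apply: mY; [exact: measurableU|exact: mC].
  have -> : cell_union n (predU W V) = cell_union n W `|` cell_union n V.
    apply/seteqP; split=> [x [w /= /orP[]]|x [] [w Ww wx]].
    + by move=> Ww wx; left; exists w.
    + by move=> Vw wx; right; exists w.
    + by exists w => //=; rewrite Ww.
    + by exists w => //=; rewrite Ww orbT.
  by move=> x /=; tauto.
- move=> A B rA rB; have [n [W [V [AW BV]]]] := join _ _ rA rB.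
  have [mA mB] : measurable A /\ measurable B by case: rA; case: rB.
  split; first exact: measurableD.
  exists n, (predD W V).
  have WV : null_set (cell_union n (predD W V) `&` cell_union n V).
    by apply: null_cell_union_overlap => w /= /andP[].
  apply: null_set_sub (null_setU (null_setU AW BV) WV).
    by apply: mY; [exact: measurableD|exact: mC].
  have sub1 : cell_union n (predD W V) `<=` cell_union n W.
    by move=> x [w /= /andP[_ Ww] wx]; exists w.
  have sub2 : cell_union n W `<=` cell_union n (predD W V) `|` cell_union n V.
    move=> x [w /= Ww wx]; have [Vw|Vw] := boolP (V w); [right|left].
      by exists w.
    by exists w => //=; rewrite Vw.
  move=> x; have := sub1 x; have := sub2 x => /=.
  by have := EM (A x); have := EM (B x); have := EM (cell_union n V x);
    have := EM (cell_union n W x); tauto.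
Qed.

(** Inside the root cell, [U] is the union over all levels of the cells that it
    contains, and outside the root cell everything is null. *)
Lemma cell_sigma_ring_local U : measurable U ->
  (forall x, U x -> cell [::] x -> exists2 w, cell w x & cell w `<=` U) ->
  <<sr cell_ring>> U.
Proof.
move=> mU Uw; have [sr0 srD srU] := smallest_sigma_ring cell_ring.
(* Index 0 carries the part of [U] outside the root cell, index [n.+1] the
   cells of level [n]. *)
have -> : U = \bigcup_n (if n is n.+1 then
    cell_union n (fun w => `[< cell w `<=` U >]) else U `\` cell [::]).
  apply/seteqP; split=> [x Ux|x [[|n] _] /=].
  - have [x0|x0] := pselect (cell [::] x); last by exists 0.
    have [w wx wU] := Uw _ Ux x0; exists (size w).+1 => //.
    by apply/cell_unionP; exists w; split=> //; exact/asboolP.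
  - by case.
  - by move/cell_unionP => [w [_ /asboolP]] + wx; apply.
apply: srU => -[|n]; apply: sub_gen_smallest.
  apply: cell_ring_null.
  apply: (@null_set_sub _ (~` cell [::])).
  - exact: measurableD.
  - by move=> x [].
  - by split=> //; apply: measurableC.
exact: cell_ring_cell_union.
Qed.

Lemma sigma_algebra_cell_sigma_ring : sigma_algebra setT <<sr cell_ring>>.
Proof.
have [sr0 srD srU] := smallest_sigma_ring cell_ring.
split=> // A sA; apply: srD => //.
by apply: cell_sigma_ring_local => // x _ x0; exists [::].
Qed.

Lemma nonneg_charge_cell_union (mu : {charge set T -> \bar R}) :
  (forall A, null_set A -> mu A = 0%E) ->
  (forall n W, (0 <= mu (cell_union n W))%E) ->
  forall A, <<sr cell_ring>> A -> (0 <= mu A)%E.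
Proof.
move=> mu0 muC; apply: nonneg_charge_setring; first exact: setring_cell_ring.
  by move=> A [].
move=> A [mA [n [W AW]]]; have mC := measurable_cell_union n W.
have := muC n W.
have CA0 : mu (cell_union n W `\` A) = 0%E.
  by apply: mu0; apply: null_set_sub AW; [exact: measurableD|right].
have AC0 : mu (A `\` cell_union n W) = 0%E.
  by apply: mu0; apply: null_set_sub AW; [exact: measurableD|left].
by rewrite (chargeDI mu mC mA) (chargeDI mu mA mC) CA0 AC0 setIC.
Qed.

End CellRing.

(** * Cells of the gasket *)

Section GasketCells.
Variables (R : realType) (q : 'I_3 -> 'rV[R]_2) (SG : set 'rV[R]_2).
Hypothesis gasket_SG : is_gasket q SG.

Definition gasket_cell (w : seq 'I_3) : set (borel_plane R) := Fword q w @` SG.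

Lemma gasket_cell_nil : gasket_cell [::] = SG.
Proof. exact: image_id. Qed.

Lemma gasket_cell_rcons w : gasket_cell w = \bigcup_j gasket_cell (rcons w j).
Proof.
have [_ _ SGE] := gasket_SG.
apply/seteqP; split=> [x [y]|x [j _ [y SGy <-]]].
  rewrite SGE => -[j _ [z SGz <-]] <-.
  by exists j => //; exists z; rewrite // Fword_rcons.
rewrite Fword_rcons; exists (Fmap q j y) => //.
by rewrite SGE; exists j => //; exists y.
Qed.

Lemma Fword_sub w x y :
  Fword q w x - Fword q w y = 2^-1 ^+ size w *: (x - y).
Proof.
elim: w => [|j w IH] /=; first by rewrite expr0 scale1r.
by rewrite exprS -scalerA -IH /Fmap -scalerBr opprD addrACA subrr addr0.
Qed.

Lemma continuous_Fword w : continuous (Fword q w).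
Proof.
have -> : Fword q w = fun x => 2^-1 ^+ size w *: x + Fword q w 0.
  by apply/funext => x; rewrite -[x in RHS]subr0 -Fword_sub subrK.
have kC : continuous (fun x : 'rV[R]_2 => 2^-1 ^+ size w *: x).
  exact: scaler_continuous.
by move=> x; exact: (cvgD (kC x) (cvg_cst _)).
Qed.

Lemma measurable_gasket_cell w : measurable (gasket_cell w).
Proof.
have [_ cSG _] := gasket_SG.
rewrite -[gasket_cell w]setCK; apply: measurableC; apply: sub_gen_smallest.
apply: closed_openC; apply: compact_closed; first exact: norm_hausdorff.
apply: continuous_compact => //.
by apply: continuous_subspaceT; exact: continuous_Fword.
Qed.

(** The cells of level [n] are copies of the bounded set [SG] scaled by
    [2^-n]. *)
Lemma small_gasket_cell (U : set 'rV[R]_2) x : open U -> U x -> SG x ->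
  exists2 w, gasket_cell w x & gasket_cell w `<=` U.
Proof.
move=> oU Ux SGx; have [_ cSG _] := gasket_SG.
have /nbhs_ballP [e /= e0 xeU] : nbhs x U by exact: open_nbhs_nbhs.
have [M [_ /(_ (`|M| + 1))]] := compact_bounded cSG.
rewrite (le_lt_trans (ler_norm M)) ?ltrDl// => /(_ isT) SGM.
set B := `|M| + 1 in SGM; have B0 : 0 < B by rewrite ltr_wpDl.
(* Points of [SG] are at distance at most [2 B], and [n <= 2 ^ n]. *)
pose n := Num.bound (2 * B / e).
have [w wn wx] : exists2 w, size w = n & gasket_cell w x.
  apply: (cell_subcell gasket_cell_rcons n (w := [::])).
  by rewrite gasket_cell_nil.
exists w => // _ [y SGy <-]; apply: xeU.
move: wx => [z SGz <-]; rewrite -ball_normE /= Fword_sub normrZ wn.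
have yz : `|z - y| <= 2 * B.
  by rewrite (le_trans (ler_normB _ _))// mulr2n mulrDl mul1r lerD//; exact: SGM.
have n0 : 0 < 2^-1 ^+ n :> R by rewrite exprn_gt0// invr_gt0.
rewrite ger0_norm ?ltW//; apply: (le_lt_trans (ler_wpM2l (ltW n0) yz)).
rewrite exprVn ltr_pdivrMl ?exprn_gt0// -ltr_pdivrMr//.
apply: (@lt_le_trans _ _ n%:R).
  by apply: archi_boundP; rewrite divr_ge0 ?mulr_ge0 ?ltW.
by rewrite -natrX ler_nat ltnW// ltn_expl.
Qed.

End GasketCells.

(** * The boundary of the cone *)

Definition coefs3 (R : nmodType) (a b c : R) : 'I_3 -> R :=
  fun i => if i == 0 then a else if i == 1 then b else c.

(** Moving by [- t (1, 1, 1)] changes [e2 = 0] into [- 2 t s + 3 t ^ 2], which is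
    negative as long as the new sum [s - 3 t] is nonnegative. *)
Lemma cone_boundary_escape (R : realFieldType) (a b c t : R) :
  0 < t -> a * b + b * c + c * a = 0 ->
  ~ (0 <= (a - t) * (b - t) + (b - t) * (c - t) + (c - t) * (a - t) /\
     0 <= a - t + (b - t) + (c - t)).
Proof. by move=> t0 e0 [h1 h2]; nra. Qed.

Lemma boundary_solid_cone (R : realType) :
  boundary (solid_cone R) =
  [set t | let: (a, b, c) := t in a * b + b * c + c * a = 0 /\ 0 <= a + b + c].
Proof.
pose e2 (t : R * R * R) := t.1.1 * t.1.2 + t.1.2 * t.2 + t.2 * t.1.1.
pose s (t : R * R * R) := t.1.1 + t.1.2 + t.2.
have c1 : continuous (fun t : R * R * R => t.1.1).
  move=> t; by apply: (@continuous_comp _ _ _ fst fst); exact: cvg_fst.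
have c2 : continuous (fun t : R * R * R => t.1.2).
  move=> t; by apply: (@continuous_comp _ _ _ fst snd); [exact: cvg_fst|exact: cvg_snd].
have c3 : continuous (fun t : R * R * R => t.2).
  move=> t; exact: cvg_snd.
have ce : continuous e2.
  by move=> t; apply: cvgD; [apply: cvgD|]; apply: cvgM;
    (exact: c1||exact: c2||exact: c3).
have cs : continuous s.
  by move=> t; apply: cvgD; [apply: cvgD|]; (exact: c1||exact: c2||exact: c3).
have SE : solid_cone R = (e2 @^-1` [set x | 0 <= x]) `&` (s @^-1` [set x | 0 <= x]).
  by apply/seteqP; split=> -[[a b] c].
have cS : closed (solid_cone R).
  rewrite SE; apply: closedI.
  - by apply: closed_comp (@closed_ge _ 0) => x _; exact: ce.
  - by apply: closed_comp (@closed_ge _ 0) => x _; exact: cs.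
rewrite /boundary -(closure_id _).1//.
apply/seteqP; split=> [[[a b] c] [[e0 s0] nI]|[[a b] c] [e0 s0]].
- split=> //; apply/eqP; rewrite eq_le e0 andbT leNgt; apply/negP => epos.
  apply: nI.
  have spos : 0 < a + b + c.
    rewrite lt_neqAle s0 andbT eq_sym; apply/eqP => sE.
    have := sqr_ge0 a; have := sqr_ge0 b; have := sqr_ge0 c.
    have cE : c = - a - b by lra.
    by move: epos; rewrite cE; nra.
  have oV : open ((e2 @^-1` [set x | 0 < x]) `&` (s @^-1` [set x | 0 < x])).
    apply: openI.
    + by apply: open_comp (@open_gt _ 0) => x _; exact: ce.
    + by apply: open_comp (@open_gt _ 0) => x _; exact: cs.
  have : (e2 @^-1` [set x | 0 < x]) `&` (s @^-1` [set x | 0 < x])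
      `<=` (solid_cone R)°.
    by rewrite -open_subsetE// => -[[x y] z] [/= ? ?]; split; apply: ltW.
  by apply; split.
- split; first by split; rewrite ?e0.
  move=> /nbhs_ballP [e /= epos sub].
  pose t := e / 2.
  have tpos : 0 < t by rewrite divr_gt0.
  have : solid_cone R (a - t, b - t, c - t).
    have bl x : ball x e (x - t).
      by rewrite /ball /= opprB addrCA subrr addr0 gtr0_norm// /t; lra.
    by apply: sub; split; [split|]; exact: bl.
  exact: cone_boundary_escape e0.
Qed.

(** * Combinations of the energy measures *)

Section EnergyMeasures.
Variables (R : realType) (q : 'I_3 -> 'rV[R]_2) (SG : set 'rV[R]_2).
Variables (h : 'I_3 -> 'rV[R]_2 -> R).
Variables (nu : 'I_3 -> {finite_measure set (borel_plane R) -> \bar R}).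
Hypothesis gasket_SG : is_gasket q SG.
Hypothesis harmonic_h : forall i, sg_harmonic q SG (h i).
Hypothesis h_vertex : forall i j, h i (q j) = (i == j)%:R.
Hypothesis energy_nu : forall i, is_energy_measure q SG (h i) (nu i).

Let cell := @gasket_cell R q SG.

Lemma vertex_val_basis i : vertex_val q (h i) [::] = unit_val R i.
Proof. by apply/funext => j; rewrite /vertex_val /= h_vertex. Qed.

Lemma energy_measure_cell g (nug : {finite_measure set (borel_plane R) -> \bar R}) w :
  sg_harmonic q SG g -> is_energy_measure q SG g nug ->
  nug (cell w) = ((5 / 3) ^+ size w *
    triangle_energy (harmonic_word (vertex_val q g [::]) w))%:E.
Proof.
move=> /sg_harmonic_rule hg [_ /(_ w) nugE].
by rewrite /cell /gasket_cell nugE harmonic_rule_energy.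
Qed.

Lemma energy_measure_tight g (nug : {finite_measure set (borel_plane R) -> \bar R}) n :
  sg_harmonic q SG g -> is_energy_measure q SG g nug ->
  nug (cell [::]) = (\sum_(w : n.-tuple 'I_3) nug (cell w))%E.
Proof.
move=> hg Eg; under eq_bigr do rewrite (energy_measure_cell _ hg Eg) size_tuple.
rewrite sumEFin (energy_measure_cell _ hg Eg) -mulr_sumr.
by rewrite sum_triangle_energy_harmonic_word expr0 mul1r.
Qed.

Lemma comb_chargeE (a b c : R) A :
  comb_charge nu a b c A = (\sum_(i < 3) (coefs3 a b c i)%:E * nu i A)%E.
Proof. by rewrite big_ord3. Qed.

Lemma comb_charge_cell a b c w : comb_charge nu a b c (cell w) =
  ((5 / 3) ^+ size w * \sum_(i < 3) coefs3 a b c i *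
     triangle_energy (harmonic_word (unit_val R i) w))%:E.
Proof.
rewrite comb_chargeE mulr_sumr -sumEFin; apply: eq_bigr => i _.
rewrite (energy_measure_cell _ (harmonic_h i) (energy_nu i)) vertex_val_basis.
by rewrite -EFinM mulrCA.
Qed.

Lemma comb_charge_cell_weight_sum a b c w : comb_charge nu a b c (cell w) =
  (2 * (1 / 5) ^+ size w * weight_sum (weight_pull_word (coefs3 a b c) w))%:E.
Proof.
rewrite comb_charge_cell cell_energy_weight !mulrA (mulrC _ 2) -!mulrA.
congr (2 * _)%:E; rewrite !mulrA -exprMn; congr (_ ^+ _ * _).
by field.
Qed.

(** A combination of the [nu i] vanishes on their common null sets, so its value
    on a union of cells of one level is a sum of masses of cells, and these are
    the sums of the pulled back weights up to positive factors. *)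
Lemma nonneg_comb_charge_cells a b c :
  nonneg_charge (comb_charge nu a b c) <->
  forall w, 0 <= weight_sum (weight_pull_word (coefs3 a b c) w).
Proof.
have mcell := measurable_gasket_cell gasket_SG.
have cellS := gasket_cell_rcons gasket_SG.
have posP w : (0 <= comb_charge nu a b c (cell w))%E =
    (0 <= weight_sum (weight_pull_word (coefs3 a b c) w)).
  by rewrite comb_charge_cell_weight_sum lee_fin pmulr_rge0//
    mulr_gt0// exprn_gt0// divr_gt0.
split=> [pos w|pos A mA]; first by rewrite -posP; apply: pos; exact: mcell.
have carried k : nu k (~` cell [::]) = 0%E.
  by rewrite /cell gasket_cell_nil; have [] := energy_nu k.
have tight k n := energy_measure_tight n (harmonic_h k) (energy_nu k).
have := @nonneg_charge_cell_union _ _ R _ _ mcell cellS _ nu tight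
  (comb_charge nu a b c).
apply.
- move=> N [_ N0]; rewrite comb_chargeE big1// => i _.
  by rewrite N0 mule0.
- move=> n W; rewrite comb_chargeE.
  under eq_bigr => i _.
    rewrite (measure_cell_union mcell cellS tight).
    under eq_bigr => w _ do rewrite (energy_measure_cell _ (harmonic_h i) (energy_nu i)).
    rewrite sumEFin -EFinM mulr_sumr vertex_val_basis.
    over.
  rewrite sumEFin lee_fin exchange_big sumr_ge0// => w _.
  under eq_bigr do rewrite mulrCA.
  rewrite -mulr_sumr cell_energy_weight !mulr_ge0 ?exprn_ge0//.
- have := smallest_sub (sigma_algebra_cell_sigma_ring mcell carried).
  apply; last exact: mA.
  move=> U oU /=; apply: cell_sigma_ring_local => //.
    exact: sub_gen_smallest.
  move=> x Ux; rewrite gasket_cell_nil => SGx.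
  exact: small_gasket_cell.
Qed.

Lemma positive_set_solid_cone : positive_set_of_coefs nu = solid_cone R.
Proof.
apply/seteqP; split=> -[[a b] c].
- rewrite /positive_set_of_coefs /= => /nonneg_comb_charge_cells pos.
  split; last exact: (pos [::]).
  rewrite leNgt; apply/negP => /(@neg_e2_neg_word R (coefs3 a b c)) [w].
  by rewrite ltNge pos.
- move=> cone; apply/nonneg_comb_charge_cells => w.
  exact: weight_cone_sum_pull_word.
Qed.

Lemma harmonic_interpolation (x : 'I_3 -> R) :
  exists2 g, sg_harmonic q SG g & vertex_val q g [::] = x.
Proof.
pose g y := \sum_(i < 3) x i * h i y.
have vg w : vertex_val q g w =
    fun j => \sum_i x i * harmonic_word (unit_val R i) w j.
  apply/funext => j; apply: eq_bigr => i _.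
  rewrite -vertex_val_basis -harmonic_rule_vertex_val//.
  exact: sg_harmonic_rule (harmonic_h i).
have g0 : vertex_val q g [::] = x.
  rewrite vg; apply/funext => j.
  by elim/ord3P: j; rewrite big_ord3 /unit_val /=; ring.
exists g => //; split.
  have -> : g = fun y => x 0 * h 0 y + x 1 * h 1 y + x 2 * h 2 y.
    by apply/funext => y; rewrite /g big_ord3.
  move=> y; have ch i : {for y, continuous (h i : subspace SG -> R)}.
    by have [+ _] := harmonic_h i; apply.
  by apply: cvgD; [apply: cvgD|]; apply: cvgMr; exact: ch.
have hg : harmonic_rule q g.
  move=> w j; rewrite !vg -!harmonic_word_sum.
  by rewrite harmonic_word_rcons.
by move=> m n; rewrite !(@harmonic_rule_energy_level _ q g [::] _ hg).
Qed.

(** A boundary point of the cone is the weight vector of some harmonic [g], and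
    the combination, being nonnegative, itself provides the energy measure of
    [g]. *)
Lemma solid_cone_boundary_energy_measures :
  boundary (solid_cone R) = energy_measure_coefs q SG nu.
Proof.
rewrite boundary_solid_cone; apply/seteqP; split=> -[[a b] c] /=.
- move=> [e0 s0].
  have [x xE] := @measure_coef_exists R (coefs3 a b c) e0 s0.
  have [g hg gx] := harmonic_interpolation x.
  have : positive_set_of_coefs nu (a, b, c).
    by rewrite positive_set_solid_cone; split; rewrite ?e0.
  move=> /nonneg_charge_finite_measure [m mE].
  exists g, m; split=> //; last by move=> A mA; rewrite mE.
  split.
    have mSG := measurable_gasket_cell gasket_SG [::].
    rewrite gasket_cell_nil in mSG.
    rewrite mE; last exact: measurableC.
    rewrite comb_chargeE big1// => i _.
    by have [-> _] := energy_nu i; rewrite mule0.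
  move=> w; rewrite harmonic_rule_energy; last exact: sg_harmonic_rule hg.
  rewrite mE; last exact: measurable_gasket_cell.
  by rewrite comb_charge_cell triangle_energy_harmonic_word gx xE.
- move=> [g [nug [hg Eg abcE]]].
  have abcE' : coefs3 a b c = measure_coef (vertex_val q g [::]).
    apply: cell_energy_weight_inj => w; rewrite -triangle_energy_harmonic_word.
    have mw := measurable_gasket_cell gasket_SG w.
    have := abcE _ mw.
    rewrite comb_charge_cell (energy_measure_cell _ hg Eg) => -[].
    by apply: mulfI; rewrite expf_neq0// mulf_neq0// invr_eq0 pnatr_eq0.
  by have := measure_coef_cone (vertex_val q g [::]); rewrite -abcE'.
Qed.

End EnergyMeasures.

Theorem theorem4p1 (R : realType) (q : 'I_3 -> 'rV[R]_2)
    (SG : set 'rV[R]_2) (h : 'I_3 -> 'rV[R]_2 -> R)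
    (nu : 'I_3 -> {finite_measure set (borel_plane R) -> \bar R})
    (equilateral_q : equilateral q)
    (gasket_SG : is_gasket q SG)
    (harmonic_h : forall i, sg_harmonic q SG (h i))
    (h_vertex : forall i j, h i (q j) = (i == j)%:R)
    (energy_nu : forall i, is_energy_measure q SG (h i) (nu i)) :
  positive_set_of_coefs nu = solid_cone R /\
  boundary (positive_set_of_coefs nu) = energy_measure_coefs q SG nu.
Proof.
have P_cone := positive_set_solid_cone gasket_SG harmonic_h h_vertex energy_nu.
split; first exact: P_cone.
rewrite P_cone.
exact: solid_cone_boundary_energy_measures gasket_SG harmonic_h h_vertex energy_nu.
Qed.
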